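(* Let $\mathfrak{M}=(W,R,V)$ be a classical modal Kripke model and $X\subseteq W$ a nonempty team. For every $\mathbf{MID}^-$-formula $\phi$: $\mathfrak{M},X\models\phi$ (team semantics) if and only if $\mathfrak{M}^\circ,X\Vdash\phi$ (single-world semantics at the point $X$ of the powerset model $\mathfrak{M}^\circ$).
   Context: **Language of $\mathbf{MID}^-$.** Fix a set $\mathrm{Prop}$ of propositional variables. Formulas: $\phi::=p\mid\bot\mid\phi\wedge\phi\mid\phi\vee\phi\mid\phi\to\phi\mid\Box\phi\mid\Diamond\phi$. **Team semantics.** A classical modal Kripke model is $\mathfrak{M}=(W,R,V)$ with $W\neq\emptyset$, $R\subseteq W\times W$, $V:\mathrm{Prop}\to\wp(W)$. A team is any $X\subseteq W$. $R(X)=\{w\in W\mid\exists v\in X,\ vRw\}$, $R(w)=R(\{w\})$; $XRY$ means $Y\subseteq R(X)$ and $Y\cap R(w)\ne\emptyset$ for every $w\in X$. Satisfaction: $\mathfrak{M},X\models p$ iff $X\subseteq V(p)$; $\mathfrak{M},X\models\bot$ iff $X=\emptyset$; $\mathfrak{M},X\models\phi\wedge\psi$ iff both hold on $X$; $\mathfrak{M},X\models\phi\vee\psi$ iff $\mathfrak{M},X\models\phi$ or $\mathfrak{M},X\models\psi$; $\mathfrak{M},X\models\phi\to\psi$ iff for all $Y\subseteq X$, $\mathfrak{M},Y\models\phi$ implies $\mathfrak{M},Y\models\psi$; $\mathfrak{M},X\models\Box\phi$ iff $\mathfrak{M},R(X)\models\phi$; $\mathfrak{M},X\models\Diamond\phi$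 iff there is $Y\subseteq W$ with $XRY$ and $\mathfrak{M},Y\models\phi$. **Powerset model.** $\mathfrak{M}^\circ=(W^\circ,\supseteq,R^\circ,V^\circ)$, where $W^\circ=\wp(W)\setminus\{\emptyset\}$; $\supseteq$ is the superset relation; $XR^\circ Y$ iff $Y\subseteq R(X)$ and $Y\cap R(w)\ne\emptyset$ for every $w\in X$; $X\in V^\circ(p)$ iff $X\subseteq V(p)$. **Single-world semantics.** On a structure $\mathfrak{N}=(U,\geq,S,V')$ (here with $U=W^\circ$, $\geq$ being $\supseteq$, $S=R^\circ$, $V'=V^\circ$): $w\Vdash p$ iff $w\in V'(p)$; $w\nVdash\bot$; $w\Vdash\phi\wedge\psi$ iff $w\Vdash\phi$ and $w\Vdash\psi$; $w\Vdash\phi\vee\psi$ iff $w\Vdash\phi$ or $w\Vdash\psi$; $w\Vdash\phi\to\psi$ iff for all $v\in U$ with $w\geq v$, $v\Vdash\phi$ implies $v\Vdash\psi$; $w\Vdash\Diamond\phi$ iff there is $v\in U$ with $wSv$ and $v\Vdash\phi$; $w\Vdash\Box\phi$ iff $v\Vdash\phi$ for all $u,v\in U$ with $w\geq u$ and $uSv$. *)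

(* Defs.v *)
From mathcomp Require Import all_boot.
From mathcomp Require Import boolp classical_sets.

Set Implicit Arguments.
Unset Strict Implicit.
Unset Printing Implicit Defensive.

Local Open Scope classical_set_scope.

Inductive form (Atom : Type) : Type :=
| Var of Atom
| Bot
| And of form Atom & form Atom
| Or of form Atom & form Atom
| Imp of form Atom & form Atom
| Box of form Atom
| Diamond of form Atom.

Arguments Bot {Atom}.

(* The set of worlds W is the type [world M]; teams are [set (world M)]. *)
Record kripke_model (Atom : Type) : Type := KripkeModel {
  world : Type;
  world_nonempty : inhabited world;
  acc : world -> world -> Prop;
  valuation : Atom -> set world }.

Arguments valuation {Atom} M p : rename.

(* R(X); R(w) for a single world w is [image_team M [set w]]. *)
Definition image_team (Atom : Type) (M : kripke_model Atom)
    (X : set (world M)) : set (world M) :=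
  [set w | exists v, X v /\ acc v w].

(* X R Y, the lifting of R to teams. *)
Definition team_acc (Atom : Type) (M : kripke_model Atom)
    (X Y : set (world M)) : Prop :=
  Y `<=` image_team X /\
  forall w, X w -> (Y `&` image_team [set w]) !=set0.

Fixpoint team_sat (Atom : Type) (M : kripke_model Atom)
    (X : set (world M)) (phi : form Atom) {struct phi} : Prop :=
  match phi with
  | Var p => X `<=` valuation M p
  | Bot => X = set0
  | And a b => team_sat X a /\ team_sat X b
  | Or a b => team_sat X a \/ team_sat X b
  | Imp a b => forall Y : set (world M),
      Y `<=` X -> team_sat Y a -> team_sat Y b
  | Box a => team_sat (image_team X) a
  | Diamond a => exists Y : set (world M), team_acc X Y /\ team_sat Y a
  end.

(* A structure (U, >=, S, V'); [geq w v] is w >= v. *)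
Record structure (Atom : Type) : Type := Structure {
  point : Type;
  geq : point -> point -> Prop;
  step : point -> point -> Prop;
  pval : Atom -> set point }.

Arguments pval {Atom} N p : rename.

Fixpoint point_sat (Atom : Type) (N : structure Atom)
    (w : point N) (phi : form Atom) {struct phi} : Prop :=
  match phi with
  | Var p => pval N p w
  | Bot => False
  | And a b => point_sat w a /\ point_sat w b
  | Or a b => point_sat w a \/ point_sat w b
  | Imp a b => forall v : point N, geq w v -> point_sat v a -> point_sat v b
  | Box a => forall u v : point N, geq w u -> step u v -> point_sat v a
  | Diamond a => exists v : point N, step w v /\ point_sat v a
  end.

Definition nonempty_team (Atom : Type) (M : kripke_model Atom) : Type :=
  {X : set (world M) | X !=set0}.

Definition powerset_model (Atom : Type) (M : kripke_model Atom) :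
    structure Atom :=
  {| point := nonempty_team M;
     geq := fun X Y => proj1_sig Y `<=` proj1_sig X;
     step := fun X Y => team_acc (proj1_sig X) (proj1_sig Y);
     pval := fun p => [set X | proj1_sig X `<=` valuation M p] |}.

(* Main.v *)
Require Import Defs.
From mathcomp Require Import all_boot.
From mathcomp Require Import boolp classical_sets.

(** Team satisfaction is downward closed and holds at the empty team. Hence the
    empty subteams, which the powerset model lacks, are harmless in the clause
    for implication, and every [Y] with [X' R Y], [X'] a subteam of [X],
    inherits satisfaction from [R(X)]. For the converse box direction, the
    subteam of the worlds of [X] that have a successor is related to [R(X)]. *)

Set Implicit Arguments.
Unset Strict Implicit.
Unset Printing Implicit Defensive.

Local Open Scope classical_set_scope.

Section Teams.
Variables (Atom : Type) (M : kripke_model Atom).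
Implicit Types (X Y Z : set (world M)) (phi : form Atom).

Lemma image_team0 : image_team (set0 : set (world M)) = set0.
Proof. by rewrite -subset0 => w [v [[]]]. Qed.

Lemma image_teamS X Y : X `<=` Y -> image_team X `<=` image_team Y.
Proof. by move=> sXY w [v [Xv vw]]; exists v; split=> //; apply: sXY. Qed.

Lemma team_acc0 : team_acc (set0 : set (world M)) set0.
Proof. by split. Qed.

(** A successor in [Y] of a world of [Z] lies in [image_team Z], so it survives the cut. This
    supplies the witness for [Diamond] on a subteam. *)
Lemma team_acc_restrict X Y Z :
  Z `<=` X -> team_acc X Y -> team_acc Z (Y `&` image_team Z).
Proof.
move=> sZX [_ meetY]; split=> [w [] //|w Zw].
have [v [Yv wv]] := meetY w (sZX w Zw).
exists v; split=> //; split=> //.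
by apply: image_teamS wv => _ ->.
Qed.

Lemma team_acc_neq0 X Y : team_acc X Y -> X !=set0 -> Y !=set0.
Proof. by move=> [_ meetY] [w /meetY[v [Yv _]]]; exists v. Qed.

(** Dead ends contribute nothing to [image_team X], and only they can violate the second clause of
    [team_acc]. *)
Lemma team_acc_image X :
  team_acc (X `&` [set w | image_team [set w] !=set0]) (image_team X).
Proof.
split=> [w [v [Xv vw]]|w [Xw [v wv]]].
  by exists v; split=> //; split=> //; exists w, v.
by exists v; split=> //; apply: image_teamS wv => _ ->.
Qed.

Lemma team_sat0 phi : team_sat (set0 : set (world M)) phi.
Proof.
elim: phi => [p||a IHa b IHb|a IHa b IHb|a IHa b IHb|a IHa|a IHa] //=.
- by left.
- by move=> Y; rewrite subset0 => ->.
- by rewrite image_team0.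
- by exists set0; split=> //; apply: team_acc0.
Qed.

Lemma team_satS phi X Y : Y `<=` X -> team_sat X phi -> team_sat Y phi.
Proof.
elim: phi X Y => [p||a IHa b IHb|a IHa b IHb|a IHa b IHb|a IHa|a IHa] X Y sYX /=.
- exact: subset_trans.
- by move=> X0; move: sYX; rewrite X0 subset0.
- by move=> [/(IHa _ _ sYX) ? /(IHb _ _ sYX)].
- by move=> [/(IHa _ _ sYX)|/(IHb _ _ sYX)]; [left|right].
- by move=> satX Z /subset_trans/(_ sYX); apply: satX.
- by apply: IHa; apply: image_teamS.
- move=> [Z [XZ satZ]]; exists (Z `&` image_team Y).
  by split; [apply: team_acc_restrict XZ|apply: IHa satZ => w []].
Qed.

End Teams.

Theorem lemma3p4 (Atom : Type) (M : kripke_model Atom)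
    (X : set (world M)) (hX : X !=set0) (phi : form Atom) :
  team_sat X phi <->
  @point_sat Atom (powerset_model M)
    (exist (fun Y : set (world M) => Y !=set0) X hX) phi.
Proof.
elim: phi X hX => [p||a IHa b IHb|a IHa b IHb|a IHa b IHb|a IHa|a IHa] X hX /=.
- by [].
- by split=> // X0; move: hX; rewrite X0 => -[].
- by rewrite (IHa _ hX) (IHb _ hX).
- by rewrite (IHa _ hX) (IHb _ hX).
- split=> [satX [Y hY] /= sYX /IHa satY|satX Y sYX satY].
    by apply/IHb; apply: satX.
  have [->|/set0P hY] := eqVneq Y set0; first exact: team_sat0.
  by apply/(IHb _ hY); apply: satX => //; apply/IHa.
- split=> [satX [Y hY] [Z hZ] /= sYX [sZ _]|satX].
    apply/IHa; apply: team_satS satX.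
    exact: subset_trans sZ (image_teamS sYX).
  have [->|/set0P hR] := eqVneq (image_team X) set0; first exact: team_sat0.
  (* A predecessor in [X] of any world of [image_team X] is not a dead end. *)
  have hY : X `&` [set w | image_team [set w] !=set0] !=set0.
    have [w [v [Xv vw]]] := hR.
    by exists v; split=> //; exists w, v.
  apply/(IHa _ hR); apply: (satX (exist _ _ hY)) => /=; first by move=> w [].
  exact: team_acc_image.
- split=> [[Y [XY satY]]|[[Y hY] /= [XY /IHa satY]]]; last by exists Y.
  (* The witness [Y] is a point, as it contains a successor of some world of [X]. *)
  have hY := team_acc_neq0 XY hX.
  by exists (exist _ Y hY); split=> //; apply/IHa.
Qed.
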